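(* Let $M_1,\dots,M_n$ be linear operators on a complex vector space that generate an extraspecial $2$-group, in the sense that $$M_k^2=-1\ \text{ for all } k,\qquad M_kM_{k+1}=-M_{k+1}M_k\ \text{ for } 1\le k\le n-1,\qquad M_iM_j=M_jM_i\ \text{ when } |i-j|\ge 2 .$$ Then the operators $\sigma_i=(1+M_i)/\sqrt{2}$, for $i=1,\dots,n-1$, give a representation of the Artin braid group $B_n$ (that is, each $\sigma_i$ is invertible and $s_i\mapsto\sigma_i$ extends to a group homomorphism from $B_n$), with $\sigma_i\sigma_j=\sigma_j\sigma_i$ for $|i-j|\ge 2$ and $\sigma_i\sigma_{i+1}\sigma_i=\sigma_{i+1}\sigma_i\sigma_{i+1}$ for $1\le i\le n-2$.
   Context: $1$ denotes the identity operator. The Artin braid group $B_n$ is the group with generators $s_1,\dots,s_{n-1}$ and relations $s_is_j=s_js_i$ for $|i-j|>1$ and $s_is_{i+1}s_i=s_{i+1}s_is_{i+1}$ for $i=1,\dots,n-2$. In the paper, the phrase ''the operators $M_k$ generate an extraspecial $2$-group'' means exactly that the relations listed in the claim hold. *)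

(* Defs.v *)
From HB Require Import structures.
From mathcomp Require Import all_boot all_order all_algebra.
From mathcomp Require Import generic_quotient.
From mathcomp Require Import boolp reals.
From mathcomp Require Export complex.

Set Implicit Arguments.
Unset Strict Implicit.
Unset Printing Implicit Defensive.

Import GRing.Theory Num.Theory.

(* A word over X is a sequence of letters: (true, x) stands for the generator *)
(* x, and (false, x) for its formal inverse.                                  *)
Definition word (X : Type) : Type := seq (bool * X).

Definition linv (X : Type) (l : bool * X) : bool * X := (~~ l.1, l.2).

Section Presentation.
Variables (X : choiceType) (r : word X -> word X -> Prop).

(* The least congruence on words that contains r and makes each letter        *)
(* cancel with its formal inverse.                                            *)
Inductive pres_eq : word X -> word X -> Prop :=
| pres_refl u : pres_eq u u
| pres_sym u v : pres_eq u v -> pres_eq v u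
| pres_trans u v w : pres_eq u v -> pres_eq v w -> pres_eq u w
| pres_cat u u' v v' :
    pres_eq u u' -> pres_eq v v' -> pres_eq (u ++ v) (u' ++ v')
| pres_cancel l : pres_eq [:: l; linv l] [::]
| pres_rel u v : r u v -> pres_eq u v.

Definition pres_eqb (u v : word X) : bool := `[< pres_eq u v >].

Lemma pres_eqb_refl : reflexive pres_eqb.
Proof. by move=> u; apply/asboolP; exact: pres_refl. Qed.

Lemma pres_eqb_sym : symmetric pres_eqb.
Proof. by move=> u v; apply/asboolP/asboolP => /pres_sym. Qed.

Lemma pres_eqb_trans : transitive pres_eqb.
Proof.
move=> v u w /asboolP uv /asboolP vw; apply/asboolP; exact: pres_trans uv vw.
Qed.

Canonical pres_equiv :=
  EquivRel pres_eqb pres_eqb_refl pres_eqb_sym pres_eqb_trans.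

(* The group < X | u = v for all u, v such that r u v >. *)
Definition presented : Type := {eq_quot pres_equiv}%qT.

HB.instance Definition _ := Choice.on presented.

Definition pres_class (u : word X) : presented := \pi_({eq_quot pres_equiv})%qT u.

Definition pres_gen (x : X) : presented := pres_class [:: (true, x)].

Definition pres_mul (a b : presented) : presented :=
  pres_class (repr (a : {eq_quot pres_equiv}%qT)
                ++ repr (b : {eq_quot pres_equiv}%qT)).

Definition word_inv (u : word X) : word X := rev (map (@linv X) u).

Definition pres_inv (a : presented) : presented :=
  pres_class (word_inv (repr (a : {eq_quot pres_equiv}%qT))).

Lemma pres_classP u v : pres_class u = pres_class v <-> pres_eq u v.
Proof.
rewrite /pres_class; split=> [/eqmodP/asboolP //|uv].
by apply/eqmodP/asboolP.
Qed.

Lemma pres_classK (a : presented) :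
  pres_class (repr (a : {eq_quot pres_equiv}%qT)) = a.
Proof. exact: reprK. Qed.

Lemma pres_mulE u v : pres_mul (pres_class u) (pres_class v) = pres_class (u ++ v).
Proof. by apply/pres_classP/pres_cat; apply/pres_classP; rewrite pres_classK. Qed.

Lemma pres_ind (P : presented -> Prop) :
  (forall u, P (pres_class u)) -> forall a, P a.
Proof. by move=> Pu a; rewrite -(pres_classK a). Qed.

Lemma pres_mulA : associative pres_mul.
Proof.
elim/pres_ind=> u; elim/pres_ind=> v; elim/pres_ind=> w.
by rewrite !pres_mulE catA.
Qed.

Lemma pres_mul1 : left_id (pres_class [::]) pres_mul.
Proof. by elim/pres_ind=> u; rewrite pres_mulE. Qed.

Lemma pres_mulr1 : right_id (pres_class [::]) pres_mul.
Proof. by elim/pres_ind=> u; rewrite pres_mulE cats0. Qed.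

Lemma linvK : involutive (@linv X).
Proof. by case=> b x; rewrite /linv /= negbK. Qed.

Lemma word_invK : involutive word_inv.
Proof.
by move=> u; rewrite /word_inv map_rev revK -map_comp (eq_map linvK) map_id.
Qed.

Lemma word_invP u : pres_eq (u ++ word_inv u) [::].
Proof.
elim: u => [|l u IHu]; first exact: pres_refl.
rewrite /word_inv /= rev_cons -cats1 -cat_cons catA.
apply: pres_trans (pres_cancel l).
rewrite -[_ ++ _]/([:: l] ++ ((u ++ word_inv u) ++ [:: linv l])).
apply: (@pres_cat [:: l] [:: l] _ [:: linv l]); first exact: pres_refl.
by apply: (@pres_cat _ [::]); [exact: IHu|exact: pres_refl].
Qed.

Lemma pres_mulV : right_inverse (pres_class [::]) pres_inv pres_mul.
Proof.
move=> a; rewrite -{1}(pres_classK a) pres_mulE.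
exact/pres_classP/word_invP.
Qed.

Lemma pres_mulVl : left_inverse (pres_class [::]) pres_inv pres_mul.
Proof.
move=> a; rewrite -{2}(pres_classK a) pres_mulE.
set u := repr _; rewrite -{2}(word_invK u).
exact/pres_classP/word_invP.
Qed.

HB.instance Definition _ :=
  isGroup.Build presented pres_mulA pres_mul1 pres_mulr1 pres_mulVl pres_mulV.

End Presentation.

(* With generators indexed from 0, 'I_n.-1 indexes s_1, ..., s_(n-1). *)
Inductive braid_rel (n : nat) : word 'I_n.-1 -> word 'I_n.-1 -> Prop :=
| braid_far (i j : 'I_n.-1) : 2 <= `|i - j| ->
    braid_rel [:: (true, i); (true, j)] [:: (true, j); (true, i)]
| braid_near (i j : 'I_n.-1) : j = i.+1 :> nat ->
    braid_rel [:: (true, i); (true, j); (true, i)]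
              [:: (true, j); (true, i); (true, j)].

Definition braid_group (n : nat) : groupType := presented (@braid_rel n).

Definition braid_gen (n : nat) (i : 'I_n.-1) : braid_group n :=
  pres_gen (@braid_rel n) i.

(* The group of invertible linear operators on V, whose product is            *)
(* composition.                                                               *)
Section GeneralLinear.
Variables (K : pzRingType) (V : lmodType K).

Definition GLpred : pred (V -> V) :=
  fun f => `[< linear f /\ bijective f >].

Record GL : Type := MkGL { GL_fun :> V -> V; GL_funP : GLpred GL_fun }.

HB.instance Definition _ := [isSub for GL_fun].
HB.instance Definition _ := [Choice of GL by <:].

Lemma GLP (f : GL) : linear f /\ bijective f.
Proof. exact/asboolP/GL_funP. Qed.

Lemma GL1_proof : GLpred idfun.
Proof. by apply/asboolP; split=> //; exists idfun. Qed.

Lemma GLM_proof (f g : GL) : GLpred (f \o g).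
Proof.
have [[fL fB] [gL gB]] := (GLP f, GLP g).
by apply/asboolP; split; [move=> a u v /=; rewrite gL fL|exact: bij_comp].
Qed.

Lemma GLV_exists (f : GL) : exists g : GL, cancel g f /\ cancel f g.
Proof.
have [fL [g fK gK]] := GLP f.
have gP : GLpred g.
  apply/asboolP; split; last by exists f.
  by move=> a u v; apply: (can_inj fK); rewrite fL !gK.
by exists (MkGL gP).
Qed.

Definition GL1 : GL := MkGL GL1_proof.
Definition GLM (f g : GL) : GL := MkGL (GLM_proof f g).
Definition GLV (f : GL) : GL := projT1 (cid (GLV_exists f)).

Lemma GL_eqP (f g : GL) : f =1 g -> f = g.
Proof. by move=> fg; apply/val_inj/funext. Qed.

Lemma GLMA : associative GLM.
Proof. by move=> f g h; apply: GL_eqP. Qed.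

Lemma GLM1l : left_id GL1 GLM.
Proof. by move=> f; apply: GL_eqP. Qed.

Lemma GLM1r : right_id GL1 GLM.
Proof. by move=> f; apply: GL_eqP. Qed.

Lemma GLMVl : left_inverse GL1 GLV GLM.
Proof.
by move=> f; apply: GL_eqP => v; case: (projT2 (cid (GLV_exists f))) => _; apply.
Qed.

Lemma GLMVr : right_inverse GL1 GLV GLM.
Proof.
by move=> f; apply: GL_eqP => v; case: (projT2 (cid (GLV_exists f))) => + _; apply.
Qed.

HB.instance Definition _ := isGroup.Build GL GLMA GLM1l GLM1r GLMVl GLMVr.

End GeneralLinear.

(* Main.v *)
Require Import Defs.
From HB Require Import structures.
From mathcomp Require Import all_boot all_order all_algebra.
From mathcomp Require Import boolp reals complex.

Set Implicit Arguments.
Unset Strict Implicit.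
Unset Printing Implicit Defensive.

Import Order.TTheory GRing.Theory Num.Theory.
Local Open Scope ring_scope.
Local Open Scope complex_scope.

(** The braid relation is an identity in the algebra generated by two
    anticommuting square roots [A], [B] of [-1].  Since [A] and [B]
    anticommute, [B (1 + A) = (1 - A) B], and [(1 + A) (1 - A) = 2]; together
    with [(1 + A)^2 = 2 A] this gives
      [(1 + A) (1 + B) (1 + A) = (1 + A)^2 + (1 + A) B (1 + A) = 2 (A + B)],
    which is symmetric in [A] and [B] ([braid_add1]).  The scalar
    [c = 1 / sqrt 2] plays no role there; it only makes [c (1 - A)] the inverse
    of [c (1 + A)], because [2 c^2 = 1] ([sigma_of_bij]).  Far commutativity is
    inherited from that of the [M_k].

    The operators are thus elements of [GL V] satisfying the defining relations
    of the braid group, and the universal property of a group given by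
    generators and relations ([presented_lift]) extends the assignment of the
    generators to a morphism. *)

Section PresentationLift.
Variables (X : choiceType) (r : word X -> word X -> Prop) (G : groupType).
Variable f : X -> G.

Local Open Scope group_scope.

(** The value in [G] of a word, the generator [x] being sent to [f x]. *)
Fixpoint word_eval (u : word X) : G :=
  if u is l :: u' then (if l.1 then f l.2 else (f l.2)^-1) * word_eval u'
  else 1.

Lemma word_eval_cat u v : word_eval (u ++ v) = word_eval u * word_eval v.
Proof. by elim: u => [|l u IHu] /=; rewrite ?mul1g // IHu mulgA. Qed.

Hypothesis f_rel : forall u v, r u v -> word_eval u = word_eval v.

Lemma word_eval_pres_eq u v : pres_eq r u v -> word_eval u = word_eval v.
Proof.
elim=> {u v} //.
- by move=> u v w _ -> _ ->.
- by move=> u u' v v' _ IHu _ IHv; rewrite !word_eval_cat IHu IHv.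
- by case=> [[] x]; rewrite /= mulg1 ?mulgV ?mulVg.
Qed.

(** Universal property of a group given by generators and relations. *)
Lemma presented_lift :
  exists rho : {multiplicative presented r -> G},
    forall x, rho (pres_gen r x) = f x.
Proof.
pose g (a : presented r) : G :=
  word_eval (repr (a : {eq_quot pres_equiv r}%qT)).
have gE u : g (pres_class r u) = word_eval u.
  by apply/word_eval_pres_eq/pres_classP; rewrite pres_classK.
have gM : {morph g : a b / a * b}.
  elim/pres_ind=> u; elim/pres_ind=> v.
  by rewrite [_ * _]pres_mulE !gE word_eval_cat.
pose gmult := isMultiplicative.Build _ _ g gM.
pose rho : {multiplicative presented r -> G} := HB.pack g gmult.
by exists rho => x; rewrite /rho /= gE /= mulg1.
Qed.

End PresentationLift.

Section SquareRootsOfMinusOne.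
Variables (K : comNzRingType) (V : lmodType K).
Implicit Types (A B : {linear V -> V}) (c : K).

Lemma add1_sub1 A v :
  A \o A =1 \- idfun -> (v + A v) - A (v + A v) = v *+ 2.
Proof.
move=> AA; have {}AA : A (A v) = - v := AA v.
by rewrite linearD AA opprD opprK addrA addrK mulr2n.
Qed.

Lemma sub1_add1 A v :
  A \o A =1 \- idfun -> (v - A v) + A (v - A v) = v *+ 2.
Proof.
move=> AA; have {}AA : A (A v) = - v := AA v.
by rewrite linearB AA opprK addrA subrK mulr2n.
Qed.

(** The sandwich [(1 + A) (1 + B) (1 + A)] equals [2 (A + B)], so it does not
    change when [A] and [B] are exchanged. *)
Lemma braid_add1 A B v :
    A \o A =1 \- idfun -> A \o B =1 \- (B \o A) ->
  let w := v + A v in let x := w + B w in x + A x = (A v + B v) *+ 2.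
Proof.
move=> AA AB w x.
have AAv : A (A v) = - v := AA v.
have BA : B (A v) = - A (B v) by rewrite [A (B v)]AB opprK.
(* the square of 1 + A is 2 A, and B (1 + A) = (1 - A) B *)
have w2 : w + A w = A v *+ 2 by rewrite /w linearD AAv addrC addrA subrK.
have Bw : B w = B v - A (B v) by rewrite /w linearD BA.
by rewrite /x linearD addrACA w2 Bw sub1_add1 // mulrnDl.
Qed.

Lemma sigma_of_bij A c :
  A \o A =1 \- idfun -> c * c * 2 = 1 -> bijective (c \*: (idfun \+ A)).
Proof.
move=> AA c2.
have halve (v : V) : c *: (c *: (v *+ 2)) = v.
  by rewrite scalerA -scaler_nat scalerA c2 scale1r.
exists (c \*: (idfun \- A)) => v /=.
  by rewrite linearZ -scalerBr add1_sub1.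
by rewrite linearZ -scalerDr sub1_add1.
Qed.

Lemma sigma_of_comm A B c :
    A \o B =1 B \o A ->
  (c \*: (idfun \+ A)) \o (c \*: (idfun \+ B)) =1
  (c \*: (idfun \+ B)) \o (c \*: (idfun \+ A)).
Proof.
move=> AB v; have {}AB : A (B v) = B (A v) := AB v.
by rewrite /= !linearZ -!scalerDr !linearD /= AB addrACA.
Qed.

Lemma sigma_of_braid A B c :
    A \o A =1 \- idfun -> B \o B =1 \- idfun -> A \o B =1 \- (B \o A) ->
  (c \*: (idfun \+ A)) \o (c \*: (idfun \+ B)) \o (c \*: (idfun \+ A)) =1
  (c \*: (idfun \+ B)) \o (c \*: (idfun \+ A)) \o (c \*: (idfun \+ B)).
Proof.
move=> AA BB AB v.
have BA : B \o A =1 \- (A \o B) by move=> u; rewrite /= [A (B u)]AB opprK.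
rewrite /= !linearZ -!scalerDr !linearZ -!scalerDr.
by rewrite (braid_add1 v AA AB) (braid_add1 v BB BA) [B v + _]addrC.
Qed.

End SquareRootsOfMinusOne.

Theorem mainTheorem1 (R : realType) (V : lmodType R[i]) (n : nat)
    (M : 'I_n -> {linear V -> V})
    (M_sqr : forall k : 'I_n, M k \o M k =1 \- idfun)
    (M_anticomm : forall k l : 'I_n, l = k.+1 :> nat ->
       M k \o M l =1 \- (M l \o M k))
    (M_comm : forall i j : 'I_n, (2 <= `|i - j|)%N -> M i \o M j =1 M j \o M i) :
  let sigma (i : 'I_n.-1) : {linear V -> V} :=
    ((Num.sqrt 2)%:C)^-1 \*: (idfun \+ M (widen_ord (leq_pred n) i)) in
  [/\ forall i : 'I_n.-1, bijective (sigma i),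
      exists rho : {multiplicative braid_group n -> GL V},
        forall i : 'I_n.-1, rho (braid_gen i) =1 sigma i,
      forall i j : 'I_n.-1, (2 <= `|i - j|)%N ->
        sigma i \o sigma j =1 sigma j \o sigma i
    & forall i j : 'I_n.-1, j = i.+1 :> nat ->
        sigma i \o sigma j \o sigma i =1 sigma j \o sigma i \o sigma j].
Proof.
move=> sigma.
have c2 : ((Num.sqrt 2)%:C)^-1 * ((Num.sqrt 2)%:C)^-1 * 2 = 1 :> R[i].
  have -> : 2 = (Num.sqrt 2)%:C * (Num.sqrt 2)%:C :> R[i].
    by rewrite -rmorphM /= -expr2 sqr_sqrtr ?ler0n // rmorph_nat.
  have s0 : (Num.sqrt 2)%:C != 0 :> R[i].
    by rewrite fmorph_eq0 sqrtr_eq0 -ltNge ltr0n.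
  by rewrite mulrA mulfVK // mulVf.
have sigma_bij i : bijective (sigma i) by exact: sigma_of_bij.
have sigma_comm (i j : 'I_n.-1) : (2 <= `|i - j|)%N ->
    sigma i \o sigma j =1 sigma j \o sigma i.
  by move=> ij; apply/sigma_of_comm/M_comm.
have sigma_braid (i j : 'I_n.-1) : j = i.+1 :> nat ->
    sigma i \o sigma j \o sigma i =1 sigma j \o sigma i \o sigma j.
  by move=> ij; apply: sigma_of_braid => //; exact: M_anticomm.
split=> //.
have sigma_GL i : GLpred (sigma i) by apply/asboolP; split=> //; exact: linearP.
pose f (i : 'I_n.-1) : GL V := MkGL (sigma_GL i).
have f_rel u v : @braid_rel n u v -> word_eval f u = word_eval f v.
  case=> [i j /sigma_comm ij | i j /sigma_braid ij] /=; rewrite !mulg1.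
    exact: GL_eqP.
  exact: GL_eqP.
have [rho rhoE] := presented_lift f_rel.
by exists rho => i v; rewrite [rho _]rhoE.
Qed.
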